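(* Let $r$ be a positive integer and let $G$ be a graph. Let $A=\{v\in V(G): d(v)>r\}$ and let $\langle A\rangle$ be the subgraph of $G$ induced by $A$. If the average degree of $\langle A\rangle$ is at most $r$, then $R(G)\geq \frac{\alpha'(G)}{\sqrt{r(r+1)}}$.
   Context: All graphs are finite and simple. For a graph $G$, the Randić index is $R(G)=\sum_{uv\in E(G)} \frac{1}{\sqrt{d(u)d(v)}}$, where $d(\cdot)$ denotes degree in $G$. $\alpha'(G)$ denotes the matching number of $G$. *)

(* Defs.v *)
From mathcomp Require Import all_boot all_order all_algebra.

Set Implicit Arguments.
Unset Strict Implicit.
Unset Printing Implicit Defensive.

Import Order.TTheory GRing.Theory Num.Theory.
Local Open Scope ring_scope.

Record sgraph := SGraph {
  vertex :> finType;
  adj : rel vertex;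
  adj_sym : symmetric adj;
  adj_irrefl : irreflexive adj }.

Section Graph.
Variable G : sgraph.

Definition edges : {set {set G}} :=
  [set [set uv.1; uv.2] | uv : G * G & adj uv.1 uv.2].

Definition deg (v : G) : nat := #|[set u | adj v u]|.

Definition matching (M : {set {set G}}) : bool :=
  (M \subset edges) && trivIset M.

Definition matching_number : nat :=
  (\max_(M : {set {set G}} | matching M) #|M|)%N.

(* An edge f is a two-element set {u, v}, so the product is d(u) d(v). *)
Definition randic (R : rcfType) : R :=
  \sum_(f in edges) 1 / Num.sqrt (\prod_(v in f) (deg v)%:R).

(* For the graph without vertices this is 0 / 0 = 0. *)
Definition avg_deg (R : rcfType) : R :=
  (\sum_(v : G) (deg v)%:R) / #|G|%:R.

Definition induced_adj (A : {set G}) : rel {v : G | v \in A} :=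
  fun u v => adj (val u) (val v).

Lemma induced_adj_sym (A : {set G}) : symmetric (@induced_adj A).
Proof. by move=> u v; apply: adj_sym. Qed.

Lemma induced_adj_irrefl (A : {set G}) : irreflexive (@induced_adj A).
Proof. by move=> u; apply: adj_irrefl. Qed.

Definition induced (A : {set G}) : sgraph :=
  SGraph (@induced_adj_sym A) (@induced_adj_irrefl A).

End Graph.

(* Main.v *)
Require Import Defs.
From mathcomp Require Import all_boot all_order all_algebra.
From mathcomp Require Import ring lra.

(** Let [B] be the complement of [A]. The edges of a matching that meet [A] are
    at most [#|A|] in number, and each edge inside [B] has weight at least
    [1 / r]; so it suffices that the edges between [A] and [B] have total weight
    at least [#|A| / sqrt (r (r + 1))]. A vertex [v] of [A] with [a]
    neighbours in [A] contributes at least [(d - a) / sqrt (r d)] to this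
    total, where [d = d(v)]. This increases with [d >= r + 1], hence is at least
    [(r + 1 - a) / sqrt (r (r + 1))], and the numbers [r + 1 - a] sum to at
    least [#|A|] since the average of [a] is at most [r]. *)

Set Implicit Arguments.
Unset Strict Implicit.
Unset Printing Implicit Defensive.

Import Order.TTheory GRing.Theory Num.Theory.
Local Open Scope ring_scope.

Lemma ler_sum_subset (R : numDomainType) (I : finType) (P Q : pred I) (F : I -> R) :
  (forall i, 0 <= F i) -> subpred P Q ->
  \sum_(i | P i) F i <= \sum_(i | Q i) F i.
Proof.
move=> F0 PQ; rewrite big_mkcond [leRHS]big_mkcond ler_sum // => i _.
by case: ifPn => [/PQ -> // | _]; case: ifP.
Qed.

Section Weights.
Variable R : rcfType.

(** With [d = a + b], the right side is [(d - a) / sqrt (r d)] and the left side is its value at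
    [d = r + 1]. The monotonicity is proved by a factorization after cross-multiplying. *)
Lemma ler_div_sqrt (r a b : nat) : (0 < r)%N -> (r < a + b)%N ->
  (r%:R + 1 - a%:R) / Num.sqrt (r%:R * (r%:R + 1))
    <= b%:R / Num.sqrt (r%:R * (a + b)%:R) :> R.
Proof.
move=> r_gt0 lt_r_ab; have r0 : 0 < r%:R :> R by rewrite ltr0n.
have le_rd : r%:R + 1 <= (a + b)%:R :> R by rewrite natr1 ler_nat.
have a0 : 0 <= a%:R :> R by [].
have s0 : 0 < r%:R * (r%:R + 1) :> R by rewrite mulr_gt0 // ltr_wpDl.
have le_st : r%:R * (r%:R + 1) <= r%:R * (a + b)%:R :> R by rewrite ler_pM2l.
have t0 := lt_le_trans s0 le_st.
have := sqr_sqrtr (ltW s0); have := sqr_sqrtr (ltW t0).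
have := ler_wsqrtr le_st; move: s0 t0.
rewrite -[0 < _ * (_ + 1)]sqrtr_gt0 -[0 < _ * (a + b)%:R]sqrtr_gt0.
move: (Num.sqrt _) (Num.sqrt _) => t s s0 t0 st t2 s2.
rewrite ler_pdivrMr // mulrAC ler_pdivlMr // -(ler_pM2l r0) -subr_ge0.
(* The extra factor [r] makes both coefficients expressible by squares: [r b = t^2 - r a] and
   [r (r + 1 - a) = s^2 - r a]. *)
have -> : r%:R * (b%:R * s) - r%:R * ((r%:R + 1 - a%:R) * t)
    = (t - s) * (s * t + r%:R * a%:R).
  have -> : r%:R * (b%:R * s) = (t ^+ 2 - r%:R * a%:R) * s.
    by rewrite t2 natrD; ring.
  have -> : r%:R * ((r%:R + 1 - a%:R) * t) = (s ^+ 2 - r%:R * a%:R) * t.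
    by rewrite s2; ring.
  by ring.
by rewrite mulr_ge0 ?subr_ge0 // addr_ge0 // mulr_ge0 // ltW.
Qed.

Lemma ler_inv_sqrt (x y : R) : 0 < x -> x <= y ->
  1 / Num.sqrt y <= 1 / Num.sqrt x.
Proof.
move=> x0 xy; have y0 := lt_le_trans x0 xy.
by rewrite !div1r lef_pV2 ?posrE ?sqrtr_gt0 ?ler_wsqrtr.
Qed.

End Weights.

Section Graph.
Variable G : sgraph.
Implicit Types (u v : G) (A : {set G}) (M : {set {set G}}).

Lemma edgesP (f : {set G}) :
  reflect (exists u v, adj u v /\ f = [set u; v]) (f \in edges G).
Proof.
apply: (iffP imsetP) => [[[u v]] /= | [u [v [uv ->]]]].
  by rewrite inE => uv ->; exists u, v.
by exists (u, v); rewrite ?inE.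
Qed.

Lemma adj_neq u v : adj u v -> u != v.
Proof. by apply: contraTneq => ->; rewrite adj_irrefl. Qed.

Lemma adj_deg_gt0 u v : adj u v -> (0 < deg u)%N.
Proof. by move=> uv; apply/card_gt0P; exists v; rewrite inE. Qed.

Lemma prod_deg_edge (R : rcfType) u v : adj u v ->
  \prod_(w in [set u; v]) (deg w)%:R = (deg u)%:R * (deg v)%:R :> R.
Proof. by move=> uv; rewrite big_setU1 ?big_set1 // inE adj_neq. Qed.

(** Blocks of [M] are disjoint, so an edge of [M] meeting [A] is the [pblock] of any vertex of [A]
    on it: these edges lie in the image of [A]. *)
Lemma matching_card_meet M A : matching M ->
  (#|[set f in M | ~~ (f \subset ~: A)]| <= #|A|)%N.
Proof.
case/andP=> _ tM; apply: leq_trans (leq_imset_card (pblock M) (mem A)).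
apply/subset_leq_card/subsetP => f; rewrite inE => /andP[fM /subsetPn[v vf]].
by rewrite inE negbK => vA; apply/imsetP; exists v; rewrite ?(def_pblock tM fM vf).
Qed.

Lemma matching_number_attained :
  exists2 M : {set {set G}}, matching M & matching_number G = #|M|.
Proof.
have [|M MM eqM] := @eq_bigmax_cond _ (@matching G) (fun M => #|M|).
  apply/card_gt0P; exists set0; rewrite unfold_in /matching sub0set.
  by apply/trivIsetP => f g; rewrite inE.
by exists M.
Qed.

Definition deg_in A v : nat := #|[set u in A | adj v u]|.

Lemma deg_split A v : deg v = (deg_in A v + deg_in (~: A) v)%N.
Proof.
rewrite /deg -(cardsID A); congr (_ + _)%N; apply: eq_card => u.
  by rewrite !inE andbC.
by rewrite !inE.
Qed.

Lemma deg_induced A (v : induced A) : deg v = deg_in A (val v).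
Proof.
rewrite /deg /deg_in -(card_imset _ val_inj); apply: eq_card => u.
apply/imsetP/idP => [[w] | ].
  by rewrite !inE => vw ->; rewrite (valP w).
rewrite inE => /andP[uA vu]; exists (Sub u uA : induced A); last by [].
by rewrite inE.
Qed.

Lemma sum_deg_in_le (R : rcfType) A (x : R) : avg_deg (induced A) R <= x ->
  \sum_(v in A) (deg_in A v)%:R <= x * #|A|%:R.
Proof.
rewrite /avg_deg (eq_bigr (fun v : induced A => (deg_in A (val v))%:R)) => [|v _]; last first.
  by rewrite deg_induced.
rewrite -(big_sub A (fun v => (deg_in A v)%:R)) card_sig.
(* For empty [A] the average is [0 / 0] and says nothing, but both sides of the goal vanish. *)
have [A0 _|A_gt0] := posnP #|A|.
  by rewrite A0 mulr0 big_pred0 // => v; rewrite (card0_eq A0).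
by rewrite ler_pdivrMr // ltr0n.
Qed.

(** Membership in [A] tells the two ends of a cross edge apart, so [(v, u)] is recovered from
    [[set v; u]] and no edge is counted twice. Edges inside [A] are dropped, as weights are
    nonnegative. *)
Lemma cross_edges_sum (R : numDomainType) A (w : {set G} -> R) :
  (forall f, 0 <= w f) ->
  \sum_(v in A) \sum_(u in ~: A | adj v u) w [set v; u]
    <= \sum_(f in edges G | ~~ (f \subset ~: A)) w f.
Proof.
move=> w0; rewrite pair_big_dep /=.
pose P := [set p : G * G | (p.1 \in A) && ((p.2 \in ~: A) && adj p.1 p.2)].
have injP : {in P &, injective (fun p : G * G => [set p.1; p.2])}.
  move=> [v u] [v' u']; rewrite !inE /=.
  move=> /and3P[vA uA _] /and3P[v'A u'A _] eq_f.
  have : v \in [set v'; u'] by rewrite -eq_f set21.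
  have : u \in [set v'; u'] by rewrite -eq_f set22.
  rewrite !in_set2 => /orP[/eqP eu|/eqP ->]; first by rewrite eu v'A in uA.
  by case/orP=> /eqP ev; [rewrite ev | rewrite -ev vA in u'A].
rewrite -(eq_bigl _ _ (fun p => in_set _ p)) -(big_imset w injP).
apply: ler_sum_subset => // f /imsetP[[v u]]; rewrite inE /= => /and3P[vA uA vu] ->.
have -> : [set v; u] \in edges G by apply/edgesP; exists v, u.
by rewrite subUset !sub1set [v \in ~: A]inE vA.
Qed.

Variables (R : rcfType) (r : nat).
Hypothesis r_gt0 : (0 < r)%N.

Let A := [set v : G | (r < deg v)%N].
Let c : R := 1 / Num.sqrt (r%:R * (r%:R + 1)).
Let w (f : {set G}) : R := 1 / Num.sqrt (\prod_(v in f) (deg v)%:R).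

(** The degree product is at most [r * r]; relaxing it to [r * (r + 1)] gives the same unit [c] as
    for the cross edges. *)
Lemma edge_weight_low (f : {set G}) : f \in edges G -> f \subset ~: A -> c <= w f.
Proof.
case/edgesP=> u [v [uv ->]]; rewrite subUset !sub1set !inE -!leqNgt.
case/andP=> ur vr; rewrite /w prod_deg_edge //; apply: ler_inv_sqrt.
  by rewrite mulr_gt0 // ltr0n ?(adj_deg_gt0 uv) // (@adj_deg_gt0 v u) // adj_sym.
by rewrite ler_pM ?ler_nat // natr1 ler_nat ltnW.
Qed.

Lemma cross_weight v : v \in A ->
  (r%:R + 1 - (deg_in A v)%:R) * c <= \sum_(u in ~: A | adj v u) w [set v; u].
Proof.
rewrite inE => vr.
have le_dv : (r < deg_in A v + deg_in (~: A) v)%N by rewrite -deg_split.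
have := ler_div_sqrt R r_gt0 le_dv; rewrite -deg_split /c div1r => /le_trans; apply.
(* The numerator counts the terms of the sum, so the comparison can be made edge by edge, using
   [deg u <= r] outside [A]. *)
have -> : (deg_in (~: A) v)%:R / Num.sqrt (r%:R * (deg v)%:R)
    = \sum_(u in ~: A | adj v u) 1 / Num.sqrt (r%:R * (deg v)%:R) :> R.
  rewrite sumr_const div1r mulr_natl; congr (_ *+ _).
  by apply: eq_card => u; rewrite [LHS]inE.
apply: ler_sum => u /andP[]; rewrite !inE -leqNgt => ur vu.
rewrite /w prod_deg_edge // [X in _ <= 1 / Num.sqrt X]mulrC.
apply: ler_inv_sqrt; last by rewrite ler_wpM2r ?ler_nat.
by rewrite mulr_gt0 // ltr0n ?(adj_deg_gt0 vu) // (@adj_deg_gt0 u v) // adj_sym.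
Qed.

End Graph.

Theorem theorem4p1 (R : rcfType) (r : nat) (G : sgraph) (r_gt0 : (0 < r)%N) :
  let A := [set v : G | (r < deg v)%N] in
  avg_deg (induced A) R <= r%:R ->
  randic G R >= (matching_number G)%:R / Num.sqrt (r%:R * (r%:R + 1)).
Proof.
move=> A /sum_deg_in_le sumA.
have [M matM ->] := matching_number_attained G.
set c := Num.sqrt _; pose w (f : {set G}) : R := 1 / Num.sqrt (\prod_(v in f) (deg v)%:R).
have c0 : 0 <= c^-1 by rewrite invr_ge0 sqrtr_ge0.
have w0 f : 0 <= w f by rewrite divr_ge0 ?sqrtr_ge0.
pose low := [pred f : {set G} | f \subset ~: A].
have lowM : #|[set f in M | low f]|%:R / c <= \sum_(f in edges G | low f) w f.
  apply: (@le_trans _ _ (\sum_(f in [set f in M | low f]) w f)).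
    rewrite mulr_natl -div1r -sumr_const.
    apply: ler_sum => f; rewrite inE => /andP[fM fl].
    by apply: edge_weight_low => //; case/andP: matM => /subsetP/(_ _ fM).
  apply: ler_sum_subset => // f; rewrite inE => /andP[fM fl].
  by case/andP: matM => /subsetP/(_ _ fM) -> _.
have crossA : #|A|%:R / c <= \sum_(f in edges G | ~~ low f) w f.
  apply: (@le_trans _ _ (\sum_(v in A) (r%:R + 1 - (deg_in A v)%:R) * (1 / c))).
    (* By [sumA], the sum of [r + 1 - deg_in A v] is at least [(r + 1) #|A| - r #|A| = #|A|]. *)
    rewrite -mulr_suml div1r ler_wpM2r // sumrB sumr_const -mulr_natr.
    by move: sumA; lra.
  apply: le_trans (ler_sum _ (fun v => @cross_weight G R r r_gt0 v)) _.
  exact: cross_edges_sum.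
rewrite /randic (bigID low) /=; apply: le_trans (lerD lowM crossA).
(* It remains to count: [M] splits into its low edges and those meeting [A], of which there are at
   most [#|A|]. *)
rewrite -mulrDl -natrD ler_wpM2r ?ler_nat //.
rewrite -(cardsID [set f | low f] M) leq_add //.
  by apply/subset_leq_card/subsetP => f; rewrite !inE.
apply: leq_trans (matching_card_meet A matM).
by apply/subset_leq_card/subsetP => f; rewrite !inE andbC.
Qed.
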